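(* Let $G=(V,E)$ be a graph. Then $\mathrm{pw}(G) \le \mathrm{fw}(G)$. Moreover, if $G$ is planar, then $G$ admits a storyplan and $\mathrm{pw}(G)=\mathrm{fw}(G)$.
   Context: Let $G=(V,E)$ have $n$ vertices and write $[n]=\{1,\dots,n\}$. A storyplan of $G$ is a pair $\langle \tau,\{D_i\}_{i\in[n]}\rangle$ where $\tau:V\to[n]$ is a bijection (a total order of $V$) and, for each vertex $v$, with $i_v=\tau(v)$ and $j_v=\max_{u\in N[v]}\tau(u)$ ($N[v]$ the closed neighborhood of $v$), the lifespan of $v$ is $[i_v,j_v]$ and $v$ is visible at every step $i\in[i_v,j_v]$; each $D_i$ is a drawing (vertices as points, edges as Jordan arcs not passing through other vertices) of the subgraph of $G$ induced by the vertices visible at step $i$, such that every $D_i$ is planar (crossing-free), each vertex is represented by the same point in all frames containing it, and each edge by the same curve in all frames containing it. The width of a storyplan is $\max_{i\in[n]}|D_i|-1$, where $|D_i|$ is the number of vertices of $D_i$. The framewidth $\mathrm{fw}(G)$ is the minimum width over all storyplans of $G$, and $\mathrm{fw}(G)=+\infty$ if $G$ has no storyplan. $\mathrm{pw}(G)$ denotes the pathwidth of $G$. *)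

(* Defs.v *)
From mathcomp Require Import all_boot all_order all_algebra.
From mathcomp Require Import all_classical all_reals all_analysis.

Set Implicit Arguments.
Unset Strict Implicit.
Unset Printing Implicit Defensive.

Import Order.TTheory GRing.Theory Num.Theory.
Import numFieldNormedType.Exports.

Local Open Scope classical_set_scope.
Local Open Scope ring_scope.

Record sgraph := SGraph {
  vertex :> finType;
  adj : rel vertex;
  adj_sym : symmetric adj;
  adj_irrefl : irreflexive adj
}.

Section Graphs.
Variable G : sgraph.

Definition closed_nbhd (v : G) : {set G} := [set u | (u == v) || adj v u]%SET.

Section Induced.
Variable W : {set G}.

Definition induced_adj : rel {v : G | v \in W} :=
  fun x y => adj (val x) (val y).

Lemma induced_adj_sym : symmetric induced_adj.
Proof. by move=> x y; rewrite /induced_adj adj_sym. Qed.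

Lemma induced_adj_irrefl : irreflexive induced_adj.
Proof. by move=> x; rewrite /induced_adj adj_irrefl. Qed.

Definition induced_subgraph : sgraph := SGraph induced_adj_sym induced_adj_irrefl.

End Induced.

Definition path_decomposition (bags : seq {set G}) : Prop :=
  [/\ forall v : G, exists2 X, X \in bags & v \in X,
      forall u v : G, adj u v -> exists2 X, X \in bags & (u \in X) && (v \in X)
    & forall (v : G) (i j k : nat), (i <= j <= k)%N -> (k < size bags)%N ->
        v \in nth finset.set0 bags i -> v \in nth finset.set0 bags k ->
        v \in nth finset.set0 bags j].

End Graphs.

Section Drawings.
Variable R : realType.

Definition jordan_arc (a b : R * R) (C : set (R * R)) : Prop :=
  exists f : R -> R * R,
    [/\ {within `[0, 1], continuous f},
        {in `[0, 1] &, injective f},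
        f 0 = a, f 1 = b & C = f @` `[0, 1]].

(* The values of [curve] on non-adjacent pairs are irrelevant. *)
Record drawing (G : sgraph) := Drawing {
  vertex_point : G -> R * R;
  curve : G -> G -> set (R * R);
  point_inj : injective vertex_point;
  curve_sym : forall u v, adj u v -> curve u v = curve v u;
  curve_arc : forall u v, adj u v -> jordan_arc (vertex_point u) (vertex_point v) (curve u v);
  curve_avoid : forall u v w,
    adj u v -> w != u -> w != v -> ~ curve u v (vertex_point w)
}.

(* An edge does not cross itself because its curve is a Jordan arc. *)
Definition crossing_free (G : sgraph) (D : drawing G) : Prop :=
  forall u v x y : G, adj u v -> adj x y ->
    [set u; v]%SET != [set x; y]%SET ->
    forall p, curve D u v p -> curve D x y p ->
      exists2 w, w \in ([set u; v] :&: [set x; y])%SET & p = vertex_point D w.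

Definition planar (G : sgraph) : Prop := exists D : drawing G, crossing_free D.

End Drawings.

Section Storyplans.
Variables (R : realType) (G : sgraph).

(* Steps are numbered 0, ..., n - 1 instead of 1, ..., n. *)
Definition last_step (tau : G -> 'I_#|G|) (v : G) : nat :=
  (\max_(u in closed_nbhd v) tau u)%N.

Definition visible (tau : G -> 'I_#|G|) (i : 'I_#|G|) : {set G} :=
  [set v | (tau v <= i <= last_step tau v)%N]%SET.

Record storyplan := Storyplan {
  tau : G -> 'I_#|G|;
  tau_bij : bijective tau;
  frame : forall i : 'I_#|G|, drawing R (induced_subgraph (visible tau i));
  frame_planar : forall i, crossing_free (frame i);
  point_const : forall i j (v : G)
    (vi : v \in visible tau i) (vj : v \in visible tau j),
    vertex_point (frame i) (exist _ v vi) = vertex_point (frame j) (exist _ v vj);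
  curve_const : forall i j (u v : G)
    (ui : u \in visible tau i) (vi : v \in visible tau i)
    (uj : u \in visible tau j) (vj : v \in visible tau j),
    adj u v ->
    curve (frame i) (exist _ u ui) (exist _ v vi) =
    curve (frame j) (exist _ u uj) (exist _ v vj)
}.

Definition storyplan_width (S : storyplan) : R :=
  (\max_(i < #|G|) #|induced_subgraph (visible (tau S) i)|)%:R - 1.

(* Widths are real numbers so that the minimum can be taken in \bar R.
   The infimum of the empty set is +oo; otherwise it is attained, see
   [framewidth_attained] and [pathwidth_attained]. *)
Definition framewidth : \bar R :=
  ereal_inf [set (storyplan_width S)%:E | S in [set: storyplan]].

Definition decomposition_width (bags : seq {set G}) : R :=
  (\max_(X <- bags) #|X|)%:R - 1.

Definition pathwidth : \bar R :=
  ereal_inf [set (decomposition_width bags)%:E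
            | bags in [set bags | path_decomposition bags]].

Lemma ereal_inf_attained (T : Type) (A : set T) (w : T -> nat) :
  A !=set0 -> exists2 a, A a &
    ereal_inf [set ((w x)%:R - 1 : R)%:E | x in A] = ((w a)%:R - 1 : R)%:E.
Proof.
move=> [a0 Aa0].
have exP : exists n, `[< exists2 x, A x & w x = n >].
  by exists (w a0); apply/asboolP; exists a0.
case: (ex_minnP exP) => n /asboolP[a Aa wa] n_min; exists a => //.
apply/eqP; rewrite eq_le; apply/andP; split.
  by apply: ereal_inf_lbound; exists a.
apply: le_ereal_inf_tmp => _ [x Ax <-].
rewrite lee_fin lerD2r ler_nat wa; apply: n_min.
by apply/asboolP; exists x.
Qed.

Lemma framewidth_attained :
  inhabited storyplan -> exists S, framewidth = (storyplan_width S)%:E.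
Proof.
move=> [S0].
have [] := @ereal_inf_attained storyplan setT
  (fun S => \max_(i < #|G|) #|induced_subgraph (visible (tau S) i)|)%N; first by exists S0.
by move=> S _ eqS; exists S.
Qed.

Lemma framewidth_infinite : ~ inhabited storyplan -> framewidth = +oo%E.
Proof.
move=> noS; rewrite /framewidth; apply/ereal_inf_pinfty => x [S _ _].
by case: noS; exists.
Qed.

Lemma path_decomposition_single : path_decomposition [:: [set: G]%SET].
Proof.
split=> [v|u v _|v i [|j] [|k] /andP[_ +] +]; rewrite ?ltnS //.
- by exists [set: G]%SET; rewrite ?mem_head ?inE.
- by exists [set: G]%SET; rewrite ?mem_head ?inE.
Qed.

Lemma pathwidth_attained :
  exists2 bags, path_decomposition bags &
    pathwidth = (decomposition_width bags)%:E.
Proof.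
have [] := @ereal_inf_attained (seq {set G})
  [set bags | path_decomposition bags] (fun bags => \max_(X <- bags) #|X|)%N.
  by exists [:: [set: G]%SET]; exact: path_decomposition_single.
by move=> bags ? ?; exists bags.
Qed.

End Storyplans.

(* Main.v *)
Require Import Defs.
From mathcomp Require Import all_boot all_order all_algebra.
From mathcomp Require Import all_classical all_reals all_analysis.

(** The visible sets of a storyplan, listed by step, form a path decomposition
of the same width.  Conversely, order the vertices by the first bag of a path
decomposition that contains them: the vertices visible when [w] appears all lie
in the first bag containing [w].  For planar [G], the restrictions of one fixed
planar drawing then serve as frames. *)

Set Implicit Arguments.
Unset Strict Implicit.
Unset Printing Implicit Defensive.

Import Order.TTheory GRing.Theory Num.Theory.

Lemma card_induced_subgraph (G : sgraph) (W : {set G}) :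
  #|induced_subgraph W| = #|W|.
Proof. by rewrite card_sig; apply: eq_card => v; rewrite !inE. Qed.

Section Visibility.
Variables (G : sgraph) (tau : G -> 'I_#|G|).

Lemma leq_last_step (u v : G) :
  (u == v) || adj v u -> (tau u <= last_step tau v)%N.
Proof. by move=> vu; apply: leq_bigmax_cond; rewrite inE. Qed.

Lemma visible_self (v : G) : v \in visible tau (tau v).
Proof. by rewrite inE leqnn leq_last_step ?eqxx. Qed.

Lemma visible_adj (u v : G) :
  adj u v -> (tau u <= tau v)%N -> u \in visible tau (tau v).
Proof. by move=> uv le_uv; rewrite inE le_uv leq_last_step ?uv ?orbT. Qed.

(** The maximum defining [last_step] is attained, as the closed neighborhood of [v] contains [v]; a
    maximizer serves as [u]. *)
Lemma visible_nbhd (i : 'I_#|G|) (v : G) : v \in visible tau i ->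
  (tau v <= i)%N /\ exists2 u, (u == v) || adj v u & (i <= tau u)%N.
Proof.
rewrite inE => /andP[le_vi le_i]; split=> //.
have v_v : v \in closed_nbhd v by rewrite inE eqxx.
have [|u uv last_u] := eq_bigmax_cond (fun u => tau u : nat)
  (_ : 0 < #|closed_nbhd v|)%N; first by apply/card_gt0P; exists v.
by exists u; [rewrite inE in uv | rewrite -last_u].
Qed.

Definition visible_bags : seq {set G} := [seq visible tau i | i : 'I_#|G|].

(** An edge is covered at the step where its later endpoint appears, and convexity holds because
    each lifespan is an interval of steps. *)
Lemma visible_path_decomposition : path_decomposition visible_bags.
Proof.
have bagP i : visible tau i \in visible_bags by apply: map_f; rewrite mem_enum.
split=> [v|u v uv|v i j k /andP[le_ij le_jk]].
- by exists (visible tau (tau v)); rewrite ?visible_self.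
- have [le_uv|/ltnW le_vu] := leqP (tau u) (tau v).
    exists (visible tau (tau v)) => //.
    by rewrite (visible_adj uv) ?visible_self.
  rewrite adj_sym in uv; exists (visible tau (tau u)) => //.
  by rewrite visible_self (visible_adj uv).
rewrite size_map size_enum_ord => lt_k.
have lt_j := leq_ltn_trans le_jk lt_k; have lt_i := leq_ltn_trans le_ij lt_j.
(* Ordinals are enumerated in increasing order, so positions in [visible_bags] are steps. *)
have nth_bag m (lt_m : (m < #|G|)%N) :
    nth finset.set0 visible_bags m = visible tau (Ordinal lt_m).
  rewrite (nth_map (Ordinal lt_m)) ?size_enum_ord //; congr visible.
  by apply: val_inj; rewrite /= nth_enum_ord.
rewrite !nth_bag !inE /= => /andP[le_vi _] /andP[_ le_k].
by rewrite (leq_trans le_vi le_ij) (leq_trans le_jk le_k).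
Qed.

Lemma visible_bags_width (R : realType) :
  decomposition_width R visible_bags =
  ((\max_(i < #|G|) #|induced_subgraph (visible tau i)|)%:R - 1)%R.
Proof.
rewrite /decomposition_width big_map big_enum /=; congr (_%:R - 1)%R.
by apply: eq_bigr => i _; rewrite card_induced_subgraph.
Qed.

End Visibility.

(** It suffices to bound the pathwidth by the width of each storyplan; if there is none, the
    right-hand side is [+oo]. *)
Lemma pathwidth_le_framewidth (R : realType) (G : sgraph) :
  (pathwidth R G <= framewidth R G)%E.
Proof.
apply: le_ereal_inf_tmp => _ [S _ <-]; apply: ereal_inf_lbound.
exists (visible_bags (tau S)); first exact: visible_path_decomposition.
by rewrite visible_bags_width.
Qed.

(** Sort the elements by [f] and send each to its position; elements with equal [f] are ordered by
    the sort. *)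
Lemma exists_monotone_order (T : finType) (f : T -> nat) :
  exists2 t : T -> 'I_#|T|,
    bijective t & forall u v, (t u <= t v)%N -> (f u <= f v)%N.
Proof.
pose r : rel T := relpre f leq; pose s := sort r (enum T).
have mem_s v : v \in s by rewrite mem_sort mem_enum.
have lt_s v : (index v s < #|T|)%N.
  by rewrite [X in (_ < X)%N]cardE -(size_sort r) index_mem.
exists (fun v => Ordinal (lt_s v)).
  apply: inj_card_bij; last by rewrite card_ord.
  by move=> u v [] /index_inj; apply.
move=> u v /= le_uv; rewrite -(nth_index u (mem_s u)) -(nth_index u (mem_s v)).
apply: (@sorted_leq_nth _ r); rewrite ?inE ?index_mem //.
- by move=> x y z; apply: leq_trans.
- by move=> x; apply: leqnn.
- by apply: sort_sorted => x y; apply: leq_total.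
Qed.

Lemma exists_order_visible_sub_bag (G : sgraph) (bags : seq {set G}) :
  path_decomposition bags ->
  exists2 t : G -> 'I_#|G|,
    bijective t & forall i, exists2 X, X \in bags & visible t i \subset X.
Proof.
case=> cover_v cover_e convex.
pose first v := find (fun X : {set G} => v \in X) bags.
have has_bag v : has (fun X : {set G} => v \in X) bags.
  by have [X bX vX] := cover_v v; apply/hasP; exists X.
have [t bij_t mono_t] := exists_monotone_order first.
exists t => // i; have [g _ gK] := bij_t; pose w := g i.
exists (nth finset.set0 bags (first w)).
  by rewrite mem_nth // -has_find.
apply/fintype.subsetP => v /visible_nbhd[].
(* With [i = t w], visibility of [v] becomes [first v <= first w <= first u] for some [u] in the
   closed neighborhood of [v]. *)
rewrite -[i]gK -/w => /mono_t le_vw [u uv /mono_t le_wu].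
(* Some bag at or after [first w] contains [v]: its own first bag if [u = v], otherwise a bag
   containing both [u] and [v], which cannot precede [first u]. *)
have [k lt_k [le_k vk]] : exists2 k, (k < size bags)%N &
    (first w <= k)%N /\ v \in nth finset.set0 bags k.
  case/orP: uv le_wu => [/eqP->|vu] le_w.
    by exists (first v); rewrite -?has_find //;
      split=> //; exact: (nth_find _ (has_bag v)).
  have [X bX /andP[vX uX]] := cover_e _ _ vu.
  exists (index X bags); rewrite ?index_mem ?nth_index //; split=> //.
  apply: leq_trans le_w _; rewrite leqNgt; apply/negP.
  by move=> /(before_find finset.set0); rewrite nth_index // uX.
(* Now [v] lies in the bags [first v] and [k], and [first w] is between them. *)
apply: (convex _ (first v) _ k) => //; first by rewrite le_vw.
exact: (nth_find _ (has_bag v)).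
Qed.

Section Restriction.
Variables (R : realType) (G : sgraph) (D : drawing R G) (W : {set G}).

Lemma induced_point_inj :
  injective (fun v : induced_subgraph W => vertex_point D (val v)).
Proof. by move=> u v /point_inj /val_inj. Qed.

Definition induced_drawing : drawing R (induced_subgraph W) :=
  @Drawing R (induced_subgraph W)
    (fun v => vertex_point D (val v)) (fun u v => curve D (val u) (val v))
    induced_point_inj
    (fun u v uv => curve_sym D uv) (fun u v uv => curve_arc D uv)
    (fun u v w uv wu wv => @curve_avoid _ _ D _ _ (val w) uv wu wv).

Lemma induced_crossing_free : crossing_free D -> crossing_free induced_drawing.
Proof.
move=> cfD u v x y uv xy uvxy p uvp xyp.
have val_set2 (a b : induced_subgraph W) :
    [set val a; val b]%SET = [set val c | c in [set a; b]%SET]%SET.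
  by rewrite imsetU1 imset_set1.
have uvxy' : [set val u; val v]%SET != [set val x; val y]%SET.
  by rewrite !val_set2 (inj_eq (imset_inj val_inj)).
have [w] := cfD _ _ _ _ uv xy uvxy' p uvp xyp.
(* Injectivity of [val] lets the image commute with the intersection, so the common endpoint [w] in
   [G] comes from a common endpoint [c] in the subgraph. *)
rewrite !val_set2 -(imsetI (in2W val_inj)) => /imsetP[c cI ->] pE.
by exists c.
Qed.

End Restriction.

(** Constancy across frames holds by computation: every frame reads its points and curves from [D]
    through [val], which forgets the membership proofs. *)
Definition planar_storyplan (R : realType) (G : sgraph) (D : drawing R G)
    (cfD : crossing_free D) (t : G -> 'I_#|G|) (bij_t : bijective t) :
    storyplan R G :=
  @Storyplan R G t bij_t (fun i => induced_drawing D (visible t i))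
    (fun i => induced_crossing_free cfD)
    (fun _ _ _ _ _ => erefl) (fun _ _ _ _ _ _ _ _ _ => erefl).

Lemma planar_storyplan_of_decomposition (R : realType) (G : sgraph)
    (bags : seq {set G}) : planar R G -> path_decomposition bags ->
  exists S : storyplan R G,
    (storyplan_width S <= decomposition_width R bags)%R.
Proof.
move=> [D cfD] /exists_order_visible_sub_bag[t bij_t sub_t].
exists (planar_storyplan cfD bij_t).
rewrite /storyplan_width /decomposition_width lerD2r ler_nat.
apply/bigmax_leqP => i _ /=; rewrite card_induced_subgraph.
have [X bX /subset_leq_card le_X] := sub_t i.
apply: leq_trans le_X _.
exact: (@leq_bigmax_seq _ bags xpredT (fun X : {set G} => #|X|) X bX isT).
Qed.

Theorem theorem1 (R : realType) (G : sgraph) :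
  (pathwidth R G <= framewidth R G)%E /\
  (planar R G ->
     inhabited (storyplan R G) /\ pathwidth R G = framewidth R G).
Proof.
split=> [|planG]; first exact: pathwidth_le_framewidth.
(* An optimal decomposition exists, so the single storyplan built from it gives both existence and
   the reverse inequality. *)
have [bags decB pwE] := pathwidth_attained R G.
have [S le_S] := planar_storyplan_of_decomposition planG decB.
split; first by exists.
apply/eqP; rewrite eq_le pathwidth_le_framewidth /= pwE.
apply: (@le_trans _ _ (storyplan_width S)%:E%E); last by rewrite lee_fin.
by apply: ereal_inf_lbound; exists S.
Qed.
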